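(* Let $G$ be a $2$-connected graph which is not a cycle. If $G$ is $\{K_{1,3},Z_1\}$-$f_1$-heavy, then $G$ is pancyclic.
   Context: All graphs are finite and simple. Let $G$ be a graph on $n$ vertices, and $d(x)$ the degree of $x$ in $G$. For a subgraph $H$ and $x,y\in V(H)$, $d_H(x,y)$ is the length of a shortest $(x,y)$-path in $H$. An induced subgraph $H$ of $G$ is called $f_1$-heavy if for every pair of vertices $u,v\in V(H)$ with $d_H(u,v)=2$ we have $\max\{d(u),d(v)\}\geq (n+1)/2$ (degrees taken in $G$). For a graph $R$, $G$ is $R$-$f_1$-heavy if every induced subgraph of $G$ isomorphic to $R$ is $f_1$-heavy; for a family $\mathcal{R}$ of graphs, $G$ is $\mathcal{R}$-$f_1$-heavy if it is $R$-$f_1$-heavy for every $R\in\mathcal{R}$. $K_{1,3}$ is the claw. $Z_1$ is the graph obtained from the path $a_1a_2a_3a_4$ by adding the edge $a_1a_3$ (a triangle with one pendant edge). A graph on $n$ vertices is pancyclic if it contains cycles of every length from $3$ to $n$. *)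

(* Defs.v *)
From mathcomp Require Import all_boot.
Set Implicit Arguments. Unset Strict Implicit. Unset Printing Implicit Defensive.

(* A finite simple graph: vertex type T : finType, adjacency e : rel T,
   assumed symmetric and irreflexive (hypotheses of the theorem). *)

Definition degree (T : finType) (e : rel T) (x : T) : nat := #|[set y | e x y]|.

Definition dist2_in (T : finType) (e : rel T) (S : {set T}) (u v : T) : Prop :=
  [/\ u \in S, v \in S, u != v, ~~ e u v & exists2 w, w \in S & e u w && e w v].

(* max{d(u),d(v)} >= (n+1)/2, written without division: 2*max >= n+1 *)
Definition f1_heavy_set (T : finType) (e : rel T) (S : {set T}) : Prop :=
  forall u v, dist2_in e S u v ->
    (#|T|.+1 <= 2 * maxn (degree e u) (degree e v))%N.

Definition induces_iso (T R : finType) (e : rel T) (eR : rel R) (S : {set T}) : Prop :=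
  exists f : R -> T, [/\ injective f, S = f @: [set: R] &
                        forall a b, e (f a) (f b) = eR a b].

Definition R_f1_heavy (T R : finType) (e : rel T) (eR : rel R) : Prop :=
  forall S : {set T}, induces_iso e eR S -> f1_heavy_set e S.

Definition claw_rel : rel 'I_4 :=
  fun i j => (i != j) && ((val i == 0) || (val j == 0))%N.

(* Z_1: path a1a2a3a4 (vertices 0,1,2,3) plus the edge a1a3 (0--2) *)
Definition Z1_rel : rel 'I_4 :=
  fun i j => ((val i, val j) \in [:: (0,1); (1,0); (1,2); (2,1); (2,3); (3,2); (0,2); (2,0)])%N.

Definition claw_Z1_f1_heavy (T : finType) (e : rel T) : Prop :=
  R_f1_heavy e claw_rel /\ R_f1_heavy e Z1_rel.

Definition connected_graph (T : finType) (e : rel T) : Prop :=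
  forall x y, connect e x y.

Definition del_rel (T : finType) (e : rel T) (v : T) : rel T :=
  fun a b => [&& e a b, a != v & b != v].

Definition two_connected (T : finType) (e : rel T) : Prop :=
  [/\ (3 <= #|T|)%N, connected_graph e &
      forall v x y, x != v -> y != v -> connect (del_rel e v) x y].

Definition is_cycle_graph (T : finType) (e : rel T) : Prop :=
  exists s : seq T, [/\ uniq s, size s = #|T|, (3 <= #|T|)%N &
    forall x y, e x y = (y == next s x) || (x == next s y)].

Definition has_cycle_of_length (T : finType) (e : rel T) (k : nat) : Prop :=
  exists s : seq T, [/\ uniq s, size s = k & cycle e s].

Definition pancyclic (T : finType) (e : rel T) : Prop :=
  forall k, (3 <= k <= #|T|)%N -> has_cycle_of_length e k.

(* Main.v *)
Require Import Defs.
From mathcomp Require Import all_boot.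
From mathcomp Require Import zify.

Set Implicit Arguments. Unset Strict Implicit. Unset Printing Implicit Defensive.

(* Call a vertex heavy if its degree is at least (n + 1) / 2, and light otherwise.
   The heaviness of claws and of Z_1's amounts to a domination property: if a
   and c are nonadjacent light neighbours of x, then every other neighbour of x
   is adjacent to both.  With 2-connectedness it follows that some vertex is
   heavy unless G is a cycle, and that the light neighbours of a heavy vertex
   form a clique unless n = 4.

   Turn the heavy vertices into a clique.  In the new graph a longest cycle
   through all heavy vertices is Hamiltonian: the successor of any vertex of the
   cycle with a neighbour off the cycle must be heavy, so a path outside the
   cycle with two distinct attachments can be absorbed by joining the two
   successors.  The Bondy-Chvatal rotation then removes the added edges.

   The resulting Hamiltonian cycle of G has two consecutive heavy vertices:
   otherwise the light vertices would form a clique of at least n / 2 vertices,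
   one of which would be heavy.  Bondy's shift argument applied to such a pair
   gives cycles of all lengths. *)

Definition hamiltonian_cycle (T : finType) (r : rel T) (s : seq T) : Prop :=
  [/\ uniq s, cycle r s & forall x, x \in s].

Definition heavy_vertex (T : finType) (e : rel T) (x : T) : bool :=
  #|T| < 2 * degree e x.

(* Making the heavy vertices a clique; the loops at heavy vertices let the list
   of all heavy vertices count as a cycle, however few they are. *)
Definition heavy_closure (T : finType) (e : rel T) : rel T :=
  fun x y => e x y || heavy_vertex e x && heavy_vertex e y.

(** * Paths, connectivity and cyclic lists *)

Lemma sym_rev_path (T : Type) (r : rel T) (sr : symmetric r) x p :
  path r (last x p) (rev (belast x p)) = path r x p.
Proof. by rewrite rev_path; apply: eq_path => u v; rewrite sr. Qed.

(** A walk is cut at its first vertex in [s]; shortening the part before it to a path keeps its last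
    vertex and stays off [s]. *)
Lemma connect_first_hit (T : finType) (r : rel T) (s : seq T) y c :
  connect r y c -> y \notin s -> c \in s ->
  exists q z, [/\ path r y q, uniq (y :: q), {in y :: q, forall u, u \notin s},
                  r (last y q) z & z \in s].
Proof.
move=> /connectP[p pp ->] {c} ys ls.
have [q [z [pq out rz zs]]] : exists q z, [/\ path r y q,
    {in y :: q, forall u, u \notin s}, r (last y q) z & z \in s].
  elim: p y pp ys ls => [|x p IHp] y /=; first by move=> _ /negPf->.
  case/andP=> ryx pp ys ls; case xs: (x \in s).
    by exists [::], x; split=> // u; rewrite inE => /eqP->.
  have [q [z [pq out rz zs]]] := IHp x pp (negbT xs) ls.
  exists (x :: q), z; split=> //=; first by rewrite ryx.
  by move=> u; rewrite inE => /orP[/eqP->//|/out].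
case: (shortenP pq) rz => q' pq' Uq' sub rz.
exists q', z; split=> // u; rewrite inE => /orP[/eqP->//|/sub uq].
by apply: out; rewrite inE uq orbT.
Qed.

Lemma connect_closed (T : finType) (r : rel T) (A : {set T}) x y :
  connect r x y -> x \in A -> (forall u v, u \in A -> r u v -> v \in A) ->
  y \in A.
Proof.
move=> /connectP[p]; elim: p x => [|z p IHp] x /= => [_ -> //|/andP[rxz rp] Ey].
by move=> xA clA; apply: (IHp z rp Ey) => //; apply: clA rxz.
Qed.

Lemma next_inj (T : eqType) (s : seq T) : uniq s -> injective (next s).
Proof. by move=> Us; apply: can_inj (prev_next Us). Qed.

Lemma next_neq_prev (T : eqType) (s : seq T) x :
  uniq s -> 2 < size s -> x \in s -> next s x != prev s x.
Proof.
move=> Us s3 xs; apply/eqP=> E.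
have : next s (next s x) = x by rewrite E next_prev.
case: (rot_to xs) => i q Eq.
have next_q y : next s y = next (x :: q) y by rewrite -Eq next_rot.
rewrite !next_q {next_q}.
have : uniq (x :: q) by rewrite -Eq rot_uniq.
have : 2 < size (x :: q) by rewrite -Eq size_rot.
case: q {Eq} => [//|y [//|z q]] _ /=; rewrite eqxx !inE !negb_or -!andbA.
move=> /and4P[/negPf xy /negPf xz _ _].
by rewrite eq_sym xy eqxx => zx; rewrite zx eqxx in xz.
Qed.

Lemma cycle_ind (T : finType) (s : seq T) (P : T -> Prop) x :
  uniq s -> (forall y, y \in s) -> P x -> (forall y, P y -> P (next s y)) ->
  forall y, P y.
Proof.
move=> Us fs Px Pn y.
have : fconnect (next s) x y.
  by rewrite (fconnect_cycle (cycle_next Us)) ?fs.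
move=> /iter_findex <-; elim: (findex _ _ _) => //= n; exact: Pn.
Qed.

(** * Domination from heavy claws and heavy Z_1's *)

Section HeavyVertices.

Variables (T : finType) (e : rel T).
Hypotheses (e_sym : symmetric e) (e_irr : irreflexive e).

Local Notation heavy := (heavy_vertex e).
Local Notation light x := (~~ heavy_vertex e x).
Local Notation e' := (heavy_closure e).

Lemma edge_neq x y : e x y -> x != y.
Proof. by move=> exy; apply/eqP=> xy; rewrite xy e_irr in exy. Qed.

Lemma dist2_heavy (S : {set T}) a x c :
  f1_heavy_set e S -> a \in S -> x \in S -> c \in S ->
  a != c -> ~~ e a c -> e x a -> e x c -> heavy a || heavy c.
Proof.
move=> fS aS xS cS nac neac exa exc.
have /fS : dist2_in e S a c.
  by split=> //; exists x => //; rewrite e_sym exa exc.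
by rewrite maxnMr leq_max.
Qed.

Lemma quad_induces (eR : rel 'I_4) (x0 x1 x2 x3 : T) :
  uniq [:: x0; x1; x2; x3] ->
  (forall i j : 'I_4, e (nth x0 [:: x0; x1; x2; x3] i)
                        (nth x0 [:: x0; x1; x2; x3] j) = eR i j) ->
  exists2 S : {set T}, induces_iso e eR S & {subset [:: x0; x1; x2; x3] <= S}.
Proof.
move=> Us He; pose f (i : 'I_4) := nth x0 [:: x0; x1; x2; x3] i.
exists (f @: [set: 'I_4]).
  exists f; split=> // i j /eqP.
  by rewrite /f nth_uniq // => /eqP/val_inj.
move=> y /(nthP x0)[i lti <-]; apply/imsetP.
by exists (Ordinal (lti : i < 4)).
Qed.

Section HeavySubgraphs.

Hypothesis HR : claw_Z1_f1_heavy e.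

(* Otherwise {x; a, c, w} induces a claw, or a triangle with a pendant edge,
   in which the light vertices a and c are at distance 2. *)
Lemma light_nbrs_dominate x a c w :
  light a -> light c -> e x a -> e x c -> a != c -> ~~ e a c ->
  e x w -> w != a -> w != c -> e w a && e w c.
Proof.
have paw a' c' : light a' -> light c' -> e x a' -> e x c' -> a' != c' ->
    ~~ e a' c' -> e x w -> w != a' -> w != c' -> e w a' -> e w c'.
  move=> La Lc xa xc nac neac xw wa wc ewa; apply/negPn/negP=> newc.
  (* The triangle a', w, x with the pendant edge x c' is a Z_1 along the path a', w, x, c'. *)
  have [|i j|S /HR.2 fS sub] := @quad_induces Z1_rel a' w x c'.
  - by rewrite /= !inE !negb_or nac (eq_sym a') wa wc (eq_sym a')
      (edge_neq xa) (eq_sym w) (edge_neq xw) (edge_neq xc).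
  - case: i => -[|[|[|[|//]]]] ?; case: j => -[|[|[|[|//]]]] ?;
      rewrite /= /Z1_rel /= ?e_irr ?xa ?xc ?xw ?ewa 1?e_sym ?xa ?xc ?xw ?ewa
         ?(negPf neac) ?(negPf newc) //; by rewrite e_sym ?(negPf neac) ?(negPf newc).
  - have : heavy a' || heavy c'.
    by apply: (dist2_heavy fS _ _ _ nac neac xa xc); apply: sub;
      rewrite !inE eqxx ?orbT.
  by rewrite (negPf La) (negPf Lc).
move=> La Lc xa xc nac neac xw wa wc.
case ewa: (e w a); first by rewrite (paw a c).
case ewc: (e w c).
  by rewrite (paw c a) // 1?eq_sym // 1?e_sym // in ewa.
have [|i j|S /HR.1 fS sub] := @quad_induces claw_rel x a c w.
- by rewrite /= !inE !negb_or nac (edge_neq xa) (edge_neq xc) (edge_neq xw)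
    (eq_sym a) (eq_sym c) wa wc.
- case: i => -[|[|[|[|//]]]] ?; case: j => -[|[|[|[|//]]]] ?;
    rewrite /= /claw_rel /= ?e_irr ?xa ?xc ?xw 1?e_sym ?xa ?xc ?xw
         ?ewa ?ewc ?(negPf neac) //; by rewrite e_sym ?(negPf neac) ?ewa ?ewc.
- have : heavy a || heavy c.
    by apply: (dist2_heavy fS _ _ _ nac neac xa xc); apply: sub;
      rewrite !inE eqxx ?orbT.
  by rewrite (negPf La) (negPf Lc).
Qed.

End HeavySubgraphs.

(** * Removing the added edges by rotation *)

Lemma heavy_closure_sym : symmetric e'.
Proof. by move=> x y; rewrite /heavy_closure e_sym andbC. Qed.

Fixpoint defects (x : T) (p : seq T) : nat :=
  if p is y :: q then ~~ e x y + defects y q else 0.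

(** The measure that each rotation decreases. *)
Definition cycle_defects (s : seq T) : nat :=
  if s is x :: p then defects x (rcons p x) else 0.

Lemma defects_cat x p q :
  defects x (p ++ q) = defects x p + defects (last x p) q.
Proof. by elim: p x => //= y p IHp x; rewrite IHp addnA. Qed.

Lemma defects_rev x p : defects (last x p) (rev (belast x p)) = defects x p.
Proof.
elim: p x => //= y p IHp x; rewrite rev_cons -cats1 defects_cat IHp /= addn0.
rewrite addnC; congr (_ + _); rewrite e_sym; congr (~~ e _ _).
by case: p {IHp} => //= z p; rewrite rev_cons last_rcons.
Qed.

Lemma cycle_defects_rot i s : cycle_defects (rot i s) = cycle_defects s.
Proof.
rewrite -{2}(cat_take_drop i s) /rot.
case: (take i s) (drop i s) => [|x p] [|y q]; rewrite ?cats0 //=.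
by rewrite !rcons_cat !defects_cat /= -!cats1 !defects_cat /=; lia.
Qed.

Lemma hamiltonian_from_closure s :
  hamiltonian_cycle e' s -> exists s', hamiltonian_cycle e s'.
Proof.
have [n] := ubnP (cycle_defects s); elim: n s => // n IHn s ltn [Us cs fs].
have [full|/forallPn[v]] := boolP [forall v, e (prev s v) v].
  exists s; split=> //; apply: cycle_from_prev => // v _; exact: (forallP full).
case/rot_to: (fs v) => i p Ep.
rewrite -(prev_rot i) // Ep.
have {}Us : uniq (v :: p) by rewrite -Ep rot_uniq.
have {}cs : cycle e' (v :: p) by rewrite -Ep rot_cycle.
have {}fs x : x \in v :: p by rewrite -Ep mem_rot.
rewrite -(cycle_defects_rot i) Ep in ltn.
have -> : prev (v :: p) v = last v p.
  have prev_last q u : v \notin q -> prev_at v v u q = last u q.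
    elim: q u => /= [|z q IHq] u; first by rewrite eqxx.
    by rewrite inE negb_or => /andP[/negPf-> /IHq].
  by case/andP: Us => /prev_last E _; rewrite /= E.
move=> {s i Ep} nlv; set x := last v p in nlv.
have [Hx Hv] : heavy x /\ heavy v.
  move: cs; rewrite /= rcons_path => /andP[_].
  by rewrite /heavy_closure (negPf nlv) => /andP[].
(* The neighbours of x and the predecessors of the neighbours of v are two sets of more than n / 2
   vertices each, so they meet. *)
have [w /andP[xw vw]] : exists w, e x w && e v (next (v :: p) w).
  apply/existsP; apply: contraTT Hx => /existsPn none.
  have := max_card ([set w | e x w] :|: next (v :: p) @^-1: [set w | e v w]).
  rewrite cardsU card_preimset; last exact: next_inj.
  rewrite (_ : _ :&: _ = set0) ?cards0 ?subn0; last first.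
    by apply/setP=> w; rewrite !inE; apply/negbTE.
  by rewrite /heavy_vertex; move: Hv; rewrite /heavy_vertex /degree; lia.
(* Since x v is not an edge, w is not v; nor is it x, the last entry. So the successor y of w lies
   in [p]. *)
have wp : w \in p.
  have := fs w; rewrite inE => /orP[/eqP E|//].
  by rewrite E (negPf nlv) in xw.
case/splitPr: p / wp => p1 p2 in IHn ltn Us cs fs x nlv Hx xw vw *.
case: p2 => [|y p2] in ltn Us cs fs x nlv Hx xw vw *.
  by rewrite /x last_cat /= e_irr in xw.
have {}vw : e v y.
  move: vw; rewrite -(next_rot (size (v :: p1)) Us) -cat_cons rot_size_cat /=.
  by rewrite eqxx.
have Ex : x = last y p2 by rewrite /x last_cat.
(* Replace the steps x -> v and w -> y by the edges x - w and v - y. *)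
apply: (IHn (w :: rev (v :: p1) ++ y :: p2)).
  move: ltn; rewrite /= !rcons_cat !defects_cat /=.
  have := defects_rev v (rcons p1 w); rewrite last_rcons belast_rcons => ->.
  rewrite -!cats1 !defects_cat /= -Ex xw (negPf nlv).
  by rewrite rev_cons last_rcons vw /=; lia.
have Es : perm_eq (w :: rev (v :: p1) ++ y :: p2) (v :: p1 ++ w :: y :: p2).
  rewrite perm_sym -cat_cons (permPl (permEl (perm_catCA (v :: p1) [:: w] _))).
  by rewrite cat1s perm_cons perm_cat2r perm_sym perm_rev.
split.
- by rewrite (perm_uniq Es).
- move: cs; rewrite /= !rcons_cat !cat_path /= => /and4P[P1 P2 _ P3].
  have := sym_rev_path heavy_closure_sym v (rcons p1 w).
  rewrite last_rcons belast_rcons => ->.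
  have -> : path e' v (rcons p1 w) by rewrite rcons_path P1 P2.
  rewrite rev_cons last_rcons /=.
  rewrite /heavy_closure vw /=; move: P3; rewrite !rcons_path -Ex => /andP[-> _].
  by rewrite xw.
- by move=> u; rewrite (perm_mem Es).
Qed.

(** * Bondy's shift at two consecutive heavy vertices *)

(* An edge from v to position t of mid and one from x to position t + k (modulo
   the size of mid) close up a cycle of length k + 3 through x and v. *)
Lemma heavy_edge_shift x v (mid : seq T) k :
  hamiltonian_cycle e (x :: v :: mid) -> heavy x -> heavy v -> k < size mid ->
  exists t, [/\ t < size mid, e v (nth x mid t) &
    e x (nth x mid (if t + k < size mid then t + k else t + k - size mid))].
Proof.
set m := size mid => -[Us _ fs] Hx Hv km.
pose g t := if t + k < m then t + k else t + k - m.
have gm t : t < m -> g t < m by rewrite /g; case: ifP; lia.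
have gsurj j : j < m -> exists2 t, t < m & g t = j.
  move=> jm; have [kj|jk] := leqP k j.
    by exists (j - k); [lia|rewrite /g subnK // jm].
  by exists (j + m - k); [lia|rewrite /g; case: ifP; lia].
have nT : #|T| = m.+2.
  have /card_uniqP Esz := Us; rewrite -[RHS]Esz.
  by apply: eq_card => y; rewrite fs.
pose A := [set t : 'I_m | e v (nth x mid t)].
pose B := [set t : 'I_m | e x (nth x mid (g t))].
(* Only z can be a neighbour of y outside [mid], hence the loss of one. *)
have bound (y z : T) (h : nat -> nat) : (forall w, w != y -> w != z -> w \in mid) ->
    (forall j, j < m -> exists2 t, t < m & h t = j) ->
    degree e y <= #|[set t : 'I_m | e y (nth x mid (h t))]|.+1.
  move=> memmid hsurj; set S := [set t : 'I_m | _].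
  have : [set w | e y w] \subset z |: [set nth x mid (h t) | t : 'I_m in S].
    apply/subsetP=> w; rewrite !inE => yw.
    case: (altP (w =P z)) => //= wz.
    have wm : w \in mid by apply: memmid => //; rewrite eq_sym (edge_neq yw).
    have jm : index w mid < m by rewrite index_mem.
    have [t tm ht] := hsurj _ jm; apply/imsetP; exists (Ordinal tm).
      by rewrite inE /= ht nth_index.
    by rewrite /= ht nth_index.
  move/subset_leq_card/leq_trans; apply; rewrite cardsU1.
  by rewrite -add1n leq_add ?leq_b1 ?leq_imset_card.
have memmid w : w != x -> w != v -> w \in mid.
  by move=> wx wv; have := fs w; rewrite !inE (negPf wx) (negPf wv).
have leA : degree e v <= #|A|.+1.
  apply: (@bound v x id) => [w wv wx|j jm]; first exact: memmid.
  by exists j.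
have leB : degree e x <= #|B|.+1 by apply: (@bound x v g).
(* The degrees of x and v add up to at least n + 1 = m + 3, so A and B have together more than m
   elements, among m positions. *)
have [t /andP[tA tB]] : exists t, (t \in A) && (t \in B).
  apply/existsP; apply: contraTT Hx => /existsPn none.
  have := max_card (A :|: B); rewrite cardsU (_ : A :&: B = set0) ?cards0 ?subn0.
    by rewrite card_ord; move: Hv; rewrite /heavy_vertex nT; lia.
  by apply/setP=> t; rewrite in_set0 in_setI; apply/negbTE.
by exists t; split=> //; move: tA tB; rewrite !inE.
Qed.

Lemma heavy_edge_pancyclic s x :
  hamiltonian_cycle e s -> heavy x -> heavy (next s x) -> 2 < #|T| -> pancyclic e.
Proof.
case=> Us cs fs Hx Hv n3.
have [i [p Ep]] : exists i, exists p : seq T, rot i s = x :: p.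
  by case/rot_to: (fs x) => i p Ep; exists i, p.
rewrite -(next_rot i) // Ep in Hv.
have {}Us : uniq (x :: p) by rewrite -Ep rot_uniq.
have {}cs : cycle e (x :: p) by rewrite -Ep rot_cycle.
have {}fs u : u \in x :: p by rewrite -Ep mem_rot.
have szp : size (x :: p) = #|T|.
  have /card_uniqP <- := Us.
  by apply: eq_card => y; rewrite fs.
case: p => [|v mid] in Hv Us cs fs szp {Ep}.
  by rewrite -szp in n3.
rewrite /= eqxx in Hv; rewrite /= in szp.
move=> k /andP[k3 kn].
rewrite -szp in kn n3; have km : k - 3 < size mid by lia.
have [t [tm vt]] := heavy_edge_shift (And3 Us cs fs) Hx Hv km.
move: cs => /= /andP[xv]; rewrite rcons_path => /andP[pmid lx].
have dt := drop_nth x tm; set a := nth x mid t in vt dt.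
have pdrop : path e a (drop t.+1 mid).
  by move: pmid; rewrite -{1}(cat_take_drop t mid) cat_path dt => /and3P[].
case: ifP => [ltk|/negbT gek] xa.
(* No wrap-around: x, v, then positions t to t + (k - 3) of [mid], and back to x. *)
- exists [:: x, v, a & take (k - 3) (drop t.+1 mid)]; split.
  + have : subseq [:: x, v, a & take (k - 3) (drop t.+1 mid)] [:: x, v & mid].
      rewrite /= !eqxx; apply: subseq_trans (drop_subseq mid t).
      by rewrite dt /= eqxx take_subseq.
    by move/subseq_uniq; apply.
  + by rewrite /= size_take size_drop; case: ifP; lia.
  + rewrite /= xv vt rcons_path take_path // e_sym (last_nth x) /=.
    rewrite size_take size_drop; have -> : (if k - 3 < size mid - t.+1 then k - 3 else size mid - t.+1) = k - 3 by case: ifP; lia.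
    case: (k - 3) xa => [|j] xa; first by rewrite addn0 in xa.
    by rewrite /= nth_take // nth_drop addSnnS.
(* Wrap-around: v, positions 0 to u of [mid], x, then from the end of [mid] backwards to position t,
   and back to v. *)
- set u := t + (k - 3) - size mid in xa.
  have ut : u < t by rewrite /u; lia.
  have um : u < size mid by lia.
  exists (v :: rcons (take u mid) (nth x mid u) ++ x :: rev (a :: drop t.+1 mid)).
  rewrite -take_nth // -dt; split.
  + rewrite (@perm_uniq _ _ (x :: v :: take u.+1 mid ++ drop t mid)).
      have sub : subseq (take u.+1 mid) (take t mid).
        by rewrite -(@take_takel _ u.+1 t) // take_subseq.
      have : subseq [:: x, v & take u.+1 mid ++ drop t mid] [:: x, v & mid].
        by rewrite /= !eqxx -{3}(cat_take_drop t mid) cat_subseq.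
      by move/subseq_uniq; apply.
    rewrite -cat_cons -cat1s perm_sym (permPl (permEl (perm_catCA [:: x] (v :: take u.+1 mid) _))).
    by rewrite perm_cat2l cat1s perm_cons perm_sym perm_rev.
  + by rewrite /= size_cat /= size_rev size_drop size_takel //; rewrite /u; lia.
  + rewrite /= rcons_cat cat_path take_path //= rcons_path.
    rewrite (take_nth x) // last_rcons e_sym xa /=.
    have := sym_rev_path e_sym a (rcons (drop t.+1 mid) x).
    rewrite last_rcons belast_rcons -dt => ->.
    rewrite rcons_path pdrop dt rev_cons last_rcons (e_sym a) vt andbT /=.
    have -> : last a (drop t.+1 mid) = last v mid.
      by rewrite -{2}(cat_take_drop t mid) last_cat dt.
    by [].
Qed.

(** * Consequences of domination in a 2-connected graph *)

Section Dominated.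

Hypothesis H2c : two_connected e.

Lemma edge_closed_full (A : {set T}) x y :
  x \in A -> (forall u v, u \in A -> e u v -> v \in A) -> y \in A.
Proof. by case: H2c => _ cG _; apply: connect_closed. Qed.

Lemma two_nbrs v : exists a b, [/\ e v a, e v b & a != b].
Proof.
case: H2c => n3 cG c2.
have /existsP[w wv] : [exists w, w != v].
  apply: contraTT n3; rewrite negb_exists => /forallP vP.
  rewrite -leqNgt -ltnS; apply: leq_ltn_trans (_ : #|[set v]| < 3).
    by apply/subset_leq_card/subsetP => x _; have := vP x; rewrite negbK inE.
  by rewrite cards1.
have [a va] : exists a, e v a.
  case/connectP: (cG v w) => [[|a p] /= pp lw]; first by rewrite lw eqxx in wv.
  by exists a; case/andP: pp.
have nva := edge_neq va.
have /existsP[u /andP[uv ua]] : [exists u, (u != v) && (u != a)].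
  apply: contraTT n3; rewrite negb_exists => /forallP vP.
  rewrite -leqNgt -ltnS; apply: leq_ltn_trans (_ : #|[set v; a]| < 3).
    apply/subset_leq_card/subsetP => x _; have := vP x.
    by rewrite !inE negb_and !negbK.
  by rewrite cards2; case: (_ != _).
(* Deleting a leaves v connected to u; the first step of such a path is the second neighbour. *)
case/connectP: (c2 a v u nva ua) => [[|b p] /= pp lw].
  by rewrite lw eqxx in uv.
by case/andP: pp => /and3P[vb _ ba] _; exists a, b; rewrite eq_sym ba.
Qed.

Lemma degree_gt1 v : 1 < degree e v.
Proof.
have [a [b [va vb ab]]] := two_nbrs v.
have <- : #|[set a; b]| = 2 by rewrite cards2 ab.
by apply/subset_leq_card/subsetP => x; rewrite !inE => /orP[]/eqP->.
Qed.

Lemma degree_gt2 x a b c : e x a -> e x b -> e x c -> uniq [:: a; b; c] ->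
  2 < degree e x.
Proof.
move=> xa xb xc U; rewrite -[3]/(size [:: a; b; c]) -(card_uniqP U).
by apply/subset_leq_card/subsetP => z; rewrite !inE => /or3P[]/eqP->.
Qed.

Lemma third_nbr x a b : 2 < degree e x -> exists w, [/\ e x w, w != a & w != b].
Proof.
move=> d3; have /existsP[w /and3P[? ? ?]] : [exists w, [&& e x w, w != a & w != b]].
  apply: contraTT d3; rewrite negb_exists => /forallP vP.
  rewrite -leqNgt -ltnS; apply: leq_ltn_trans (_ : #|[set a; b]| < 3).
    apply/subset_leq_card/subsetP => w; rewrite !inE => xw.
    by have := vP w; rewrite xw /= negb_and !negbK.
  by rewrite cards2; case: (_ != _).
by exists w.
Qed.

(** The conclusion of [light_nbrs_dominate], the only form in which claws and Z_1's enter below. *)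
Hypothesis dominate : forall x a c w,
  light a -> light c -> e x a -> e x c -> a != c -> ~~ e a c ->
  e x w -> w != a -> w != c -> e w a && e w c.

(** By domination a, c and their common neighbours are closed under adjacency, so they are all the
    vertices; lightness of a then bounds its degree by 2. *)
Lemma twin_light_card a c :
  light a -> light c -> a != c -> ~~ e a c -> e a =1 e c ->
  #|T| = (degree e a).+2 /\ #|T| <= 4.
Proof.
move=> La Lc ac nac eac.
have full y : y \in c |: (a |: [set z | e a z]).
  apply: (@edge_closed_full _ a); first by rewrite !inE eqxx orbT.
  move=> u v; rewrite !inE => /or3P[/eqP->|/eqP->|au] uv.
  - by rewrite eac uv !orbT.
  - by rewrite uv !orbT.
  - case: (altP (v =P c)) => //= vc; case: (altP (v =P a)) => //= va.
    have ua : e u a by rewrite e_sym.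
    have uc : e u c by rewrite e_sym -eac.
    by have /andP[va' _] := dominate La Lc ua uc ac nac uv va vc; rewrite e_sym.
have nT : #|T| = (degree e a).+2.
  rewrite -cardsT (_ : [set: T] = c |: (a |: [set z | e a z])).
    rewrite !cardsU1 !inE e_irr (negPf nac) eq_sym (negPf ac) /=.
    by rewrite !add1n.
  by apply/setP=> y; rewrite inE full.
by split=> //; move: La; rewrite /heavy_vertex nT; lia.
Qed.

(** Here a and c must be twins, so n = 4. A third neighbour h' of h is adjacent to both, giving the
    triangle a, h, h' and the 4-cycle a, h, c, h'. *)
Lemma light_nbrs_adj_or_pancyclic h a c :
  heavy h -> light a -> light c -> e h a -> e h c -> a != c -> ~~ e a c ->
  pancyclic e.
Proof.
move=> Hh La Lc ha hc ac nac.
have sub a' c' : light a' -> light c' -> e h a' -> e h c' -> a' != c' ->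
    ~~ e a' c' -> forall y, e a' y -> e c' y.
  move=> La' Lc' ha' hc' ac' nac' y ay; apply: contraT => ncy; case/negP: (La').
  apply: leq_trans Hh _; rewrite leq_mul2l /=.
  (* All neighbours of h other than a' and c' lie in M minus h, so h has degree at most |M| + 1; a
     private neighbour y of a' would give a' at least that degree and make it heavy. *)
  pose M := [set z | e a' z && e c' z].
  have hM : h \in M by rewrite inE !(e_sym _ h) ha' hc'.
  have le1 : degree e h <= #|a' |: (c' |: M :\ h)|.
    apply/subset_leq_card/subsetP => z; rewrite !inE => hz.
    case: (altP (z =P a')) => //= za; case: (altP (z =P c')) => //= zc.
    have /andP[Ea Ec] := dominate La' Lc' ha' hc' ac' nac' hz za zc.
    by rewrite eq_sym (edge_neq hz) !(e_sym _ z) Ea Ec.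
  have le2 : #|y |: M| <= degree e a'.
    by apply/subset_leq_card/subsetP=> z; rewrite !inE => /orP[/eqP->|/andP[]].
  apply: leq_trans le1 (leq_trans _ le2).
  rewrite !cardsU1 (cardsD1 h M) hM !inE (negPf ncy) andbF /=.
  exact: leq_add (leq_b1 _) (leq_add (leq_b1 _) (leqnn _)).
have eac : e a =1 e c.
  move=> y; apply/idP/idP; first by apply: (sub a c).
  by apply: (sub c a); rewrite // 1?eq_sym // e_sym.
have [nT n4] := twin_light_card La Lc ac nac eac.
have d2 := degree_gt1 a; have {}n4 : #|T| = 4 by lia.
have dh : 2 < degree e h by move: Hh; rewrite /heavy_vertex n4; lia.
have [h' [hh' h'a h'c]] := third_nbr a c dh.
have /andP[h'a' h'c'] := dominate La Lc ha hc ac nac hh' h'a h'c.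
move=> k; rewrite n4; case: k => [|[|[|[|[|k]]]]] // _.
- exists [:: a; h; h']; rewrite /= !inE negb_or h'a' hh' e_sym ha.
  by rewrite (edge_neq hh') eq_sym (edge_neq ha) eq_sym h'a.
- exists [:: a; h; c; h']; rewrite /= !inE !negb_or h'a' hc (e_sym a) ha.
  rewrite (e_sym c) h'c' (edge_neq hh') (edge_neq hc) ac.
  by rewrite eq_sym (edge_neq ha) eq_sym h'a eq_sym h'c.
Qed.

(** Neighbours of a vertex of degree at least 3 are pairwise adjacent, since otherwise they are
    twins, n <= 4 and that vertex is heavy. So x and its neighbours are the whole graph, and x is
    heavy. *)
Lemma degree_le2 : (forall x, light x) -> forall x, degree e x <= 2.
Proof.
move=> allL x; rewrite leqNgt; apply/negP=> d3.
have [n3 _ _] := H2c.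
have clique y a c : 2 < degree e y -> e y a -> e y c -> a != c -> e a c.
  move=> dy ya yc ac; apply/negPn/negP=> nac.
  have [w [yw wa wc]] := third_nbr a c dy.
  have sub a' c' : e y a' -> e y c' -> w != a' -> w != c' ->
      a' != c' -> ~~ e a' c' -> forall z, e a' z -> e c' z.
    move=> ya' yc' wa' wc' ac' nac' z az; apply/negPn/negP=> ncz.
    have zc : z != c' by apply: contraNneq nac' => <-.
    have za : z != a' by rewrite eq_sym (edge_neq az).
    have /andP[wa'' wc''] := dominate (allL a') (allL c') ya' yc' ac' nac' yw wa' wc'.
    (* As y and z are nonadjacent, domination at a' makes w adjacent to z; domination at w then
       makes z adjacent to c'. *)
    have nyz : ~~ e y z.
      apply: contra ncz => yz.
      by have /andP[_] := dominate (allL a') (allL c') ya' yc' ac' nac' yz za zc; rewrite e_sym.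
    have ay : e a' y by rewrite e_sym.
    have yz : y != z by apply: contraNneq ncz => <-; rewrite e_sym.
    have aw : e a' w by rewrite e_sym.
    have wy : w != y by rewrite eq_sym (edge_neq yw).
    have wz : w != z by apply: contraNneq nyz => <-.
    have /andP[_ wz'] := dominate (allL y) (allL z) ay az yz nyz aw wy wz.
    have /andP[_] := dominate (allL a') (allL c') wa'' wc'' ac' nac' wz' za zc.
    by rewrite e_sym (negPf ncz).
  have eac : e a =1 e c.
    move=> z; apply/idP/idP; first by apply: (sub a c).
    by apply: (sub c a); rewrite // 1?eq_sym // e_sym.
  have [_ n4] := twin_light_card (allL a) (allL c) ac nac eac.
  by move: (allL y); rewrite /heavy_vertex; lia.
have full z : z \in x |: [set z | e x z].
  apply: (@edge_closed_full _ x); first by rewrite !inE eqxx.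
  move=> u v; rewrite !inE => /orP[/eqP->->|xu uv]; first by rewrite orbT.
  case: (altP (v =P x)) => //= vx; apply: (clique u) => //; last by rewrite eq_sym.
    have [a [xa au _]] := third_nbr u u d3.
    have [b [xb bu ba]] := third_nbr u a d3.
    apply: (@degree_gt2 u x a b); first by rewrite e_sym.
    - by apply: clique d3 _ _ _; rewrite // eq_sym.
    - by apply: clique d3 _ _ _; rewrite // eq_sym.
    - by rewrite /= !inE negb_or (edge_neq xa) (edge_neq xb) eq_sym ba.
  by rewrite e_sym.
have : #|T| <= (degree e x).+1.
  rewrite -cardsT -add1n (leq_trans _ (leq_add (leq_b1 (x \notin [set z | e x z])) (leqnn _))) //.
  by rewrite -cardsU1; apply/subset_leq_card/subsetP=> z _.
by move: (allL x); rewrite /heavy_vertex; lia.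
Qed.

(** A path between two neighbours of v that avoids v closes up to a cycle through v. The degree
    bound leaves no other edges at its vertices, so by connectedness it is everything. *)
Lemma degree_le2_cycle : (forall x, degree e x <= 2) -> is_cycle_graph e.
Proof.
move=> d2; have [n3 _ c2] := H2c.
have /card_gt0P[v _] : 0 < #|T| by lia.
have [a [b [va vb ab]]] := two_nbrs v.
have av : a != v by rewrite eq_sym (edge_neq va).
have bv : b != v by rewrite eq_sym (edge_neq vb).
have /connectP[p0 pp0 lb] := c2 v a b av bv.
case: (shortenP pp0) lb => p pp Up _ lb {p0 pp0}.
pose s := v :: a :: p.
have vp : v \notin a :: p.
  rewrite inE negb_or eq_sym av /=; elim: (p) (a) pp => //= x q IHq y.
  by case/andP=> /and3P[_ _ xv] /IHq; rewrite inE negb_or eq_sym xv.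
have ep : path e a p by apply: sub_path pp => x y /and3P[].
have Us : uniq s by rewrite /s cons_uniq vp.
have p0 : p != [::] by case: (p) lb ab => //= ->; rewrite eqxx.
have cs : cycle e s by rewrite /s /= va rcons_path ep -lb e_sym.
have e_nx x : x \in s -> e x (next s x) by apply: next_cycle.
have e_pv x : x \in s -> e x (prev s x) by move=> xs; rewrite e_sym; apply: prev_cycle.
have s3 : 2 < size s by rewrite /s; case: (p) p0.
have npv x : x \in s -> next s x != prev s x by apply: next_neq_prev.
have edge x y : x \in s -> e x y = (y == next s x) || (y == prev s x).
  move=> xs; apply/idP/orP=> [xy|[]/eqP->]; [|exact: e_nx|exact: e_pv].
  case: (altP (y =P _)) => [|yn]; [by left|right; apply: contraT => yp].
  have := d2 x; rewrite leqNgt (@degree_gt2 x y (next s x) (prev s x)) ?e_nx ?e_pv //=.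
  by rewrite !inE negb_or yn yp npv.
have full y : y \in s.
  have : y \in [set z | z \in s].
    apply: (@edge_closed_full _ v) => [|x z]; first by rewrite in_set mem_head.
    rewrite 2!in_set => xs; rewrite edge // => /orP[]/eqP->.
      by rewrite mem_next.
    by rewrite mem_prev.
  by rewrite in_set.
exists s; split=> //.
  by rewrite -(card_uniqP Us); apply: eq_card => y; rewrite full.
move=> x y; rewrite edge //; congr orb; apply/eqP/eqP=> ->.
  by rewrite next_prev.
by rewrite prev_next.
Qed.

(** * A Hamiltonian cycle in the closure *)

(** If this fails, [light_nbrs_adj_or_pancyclic] already concludes. *)
Hypothesis heavy_clique : forall h a c,
  heavy h -> light a -> light c -> e h a -> e h c -> a != c -> e a c.

Section OneHeavy.

Variable h0 : T.
Hypothesis heavy_h0 : heavy h0.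

Lemma heavy_closure_light x y : light x -> e' x y -> e x y.
Proof. by move=> /negPf Lx; rewrite /heavy_closure Lx orbF. Qed.

Lemma sub_heavy_closure : subrel e e'.
Proof. by move=> x y xy; rewrite /heavy_closure xy. Qed.

(** Size 2 is allowed, so that two heavy vertices alone count as a cycle. *)
Definition heavy_cycle (s : seq T) :=
  [/\ uniq s, cycle e' s, forall h, heavy h -> h \in s & 1 < size s].

Lemma heavy_cycle_rot i s : heavy_cycle s -> heavy_cycle (rot i s).
Proof.
case=> Us cs Hs s2; split; rewrite ?rot_uniq ?rot_cycle ?size_rot //.
by move=> h; rewrite mem_rot; apply: Hs.
Qed.

(** If x1 is light, then y, light as well, is not adjacent to x1, else it fits between x and x1. So
    [heavy_clique] makes x light, and domination at x makes y adjacent to the predecessor l of x: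
    now y fits between l and x. *)
Lemma attached_next_heavy x x1 p y :
  heavy_cycle [:: x, x1 & p] ->
  (forall s, heavy_cycle s -> size s <= size [:: x, x1 & p]) ->
  y \notin [:: x, x1 & p] -> e x y -> heavy x1.
Proof.
set s := [:: x, x1 & p] => -[Us cs Hs _] maxs ys xy; apply: contraT => Lx1.
have longer s' : perm_eq s' (y :: s) -> cycle e' s' -> False.
  move=> Es' cs'; have sz : size s' = (size s).+1 by rewrite (perm_size Es').
  suff /maxs : heavy_cycle s' by rewrite sz ltnn.
  split; rewrite ?sz ?(perm_uniq Es') ?cons_uniq ?ys // => h /Hs hs.
  by rewrite (perm_mem Es') inE hs orbT.
have Ly : light y by apply: contra ys; apply: Hs.
have yx1 : y != x1 by apply: contraNneq ys => ->; rewrite !inE eqxx orbT.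
have yx : y != x by apply: contraNneq ys => ->; rewrite !inE eqxx.
have exx1 : e x x1.
  by move: cs => /= /andP[]; rewrite heavy_closure_sym e_sym; move/heavy_closure_light->.
have nyx1 : ~~ e y x1.
  apply/negP=> yx1'; apply: (longer [:: x, y, x1 & p]).
    by apply/permEl; apply: (perm_catCA [:: x] [:: y]).
  move: cs => /= /andP[_ ->].
  by rewrite !sub_heavy_closure.
have Lx : light x.
  by apply: contra nyx1 => Hx; apply: heavy_clique Hx _ _ _ _ _.
(* The heavy vertex [h0] is on the cycle and differs from x and x1, so l is not x1. *)
have p0 : p != [::].
  apply/eqP=> p0; have := Hs _ heavy_h0; rewrite /s p0 !inE.
  by case/orP=> /eqP E; move: heavy_h0; rewrite E ?(negPf Lx) ?(negPf Lx1).
pose l := last x1 p.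
have lp : l \in p by rewrite /l; case: (p) p0 => //= z q _; rewrite mem_last.
have xl : e x l.
  move: cs; rewrite /= rcons_path => /and3P[_ _].
  by rewrite heavy_closure_sym => /(heavy_closure_light Lx).
have ly : l != y by apply: contraNneq ys => <-; rewrite !inE lp !orbT.
have lx1 : l != x1.
  by apply: contraTneq lp => ->; move: Us => /= /and3P[].
have /andP[ely _] := dominate Ly Lx1 xy exx1 yx1 nyx1 xl ly lx1.
case: (longer [:: y, x, x1 & p]) => //.
move: cs; rewrite /= !rcons_path => /and3P[-> -> _].
by rewrite !sub_heavy_closure // e_sym.
Qed.

(** A vertex y off the cycle is attached at x; connectedness after deleting x leads from y to a
    second attachment z. *)
Lemma heavy_cycle_extend s y0 :
  heavy_cycle s -> y0 \notin s ->
  (forall s', heavy_cycle s' -> size s' <= size s) -> False.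
Proof.
move=> hs ys0 maxs; have [_ cG c2] := H2c.
have h0s : h0 \in s by case: hs => _ _ Hs _; apply: Hs.
have [q0 [x [_ _ out0 yx xs]]] := connect_first_hit (cG y0 h0) ys0 h0s.
have ys : last y0 q0 \notin s by apply: out0; rewrite mem_last.
move: (last y0 q0) yx ys => {h0s q0 out0 ys0} y yx ys.
case/rot_to: xs => i p Ep.
have {}hs : heavy_cycle (x :: p) by rewrite -Ep; apply: heavy_cycle_rot.
have {}ys : y \notin x :: p by rewrite -Ep mem_rot.
have {}maxs s' : heavy_cycle s' -> size s' <= size (x :: p).
  by rewrite -Ep size_rot; apply: maxs.
have [Us cs Hs s2] := hs.
have [c cp] : exists c, c \in p.
  by case: (p) s2 => // c p' _; exists c; rewrite inE eqxx.
have cx : c != x by apply: contraTneq cp => ->; case/andP: Us.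
have yx' : y != x by apply: contraNneq ys => ->; rewrite inE eqxx.
have cs' : c \in x :: p by rewrite inE cp orbT.
have [q [z [pq Uq out rz zs]]] := connect_first_hit (c2 x y c yx' cx) ys cs'.
case/and3P: rz => lz _ zx; move: zs; rewrite inE (negPf zx) /= => zp.
have {}pq : path e y q by apply: sub_path pq => u v /and3P[].
case/splitPr: p / zp => p1 p2 in Ep hs ys maxs Us cs Hs s2 cp cs' out *.
(* The defaults of [head] are the true successors: z follows x if [p1] is empty, and x follows z if
   [p2] is empty. *)
have x1H : heavy (head z p1).
  case: p1 {Ep s2 Hs cs cp cs' Us out} hs ys maxs => [|x1 p1] hs ys maxs;
    by apply: attached_next_heavy hs maxs ys _; rewrite e_sym.
have z1H : heavy (head x p2).
  have hs' : heavy_cycle (z :: p2 ++ x :: p1).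
    by have := heavy_cycle_rot (size (x :: p1)) hs; rewrite -cat_cons rot_size_cat.
  have sz : size (z :: p2 ++ x :: p1) = size (x :: p1 ++ z :: p2).
    by rewrite -!cat_cons !size_cat addnC.
  have ls : last y q \notin z :: p2 ++ x :: p1.
    by rewrite -cat_cons mem_cat orbC -mem_cat out ?mem_last.
  have lz' : e z (last y q) by rewrite e_sym.
  case: p2 {Ep s2 Hs cs cp cs' Us out ys hs maxs} hs' sz ls (maxs) => [|z1 p2] hs' sz ls maxs;
    by apply: attached_next_heavy hs' _ ls lz' => s' /maxs; rewrite -sz.
(* Absorb y :: q between x and z, and join the successors of x and of z. *)
pose s' := x :: (y :: q) ++ z :: rev p1 ++ p2.
have Es' : perm_eq s' ((y :: q) ++ (x :: p1 ++ z :: p2)).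
  apply: (perm_trans (permEl (perm_catCA [:: x] (y :: q) _))).
  rewrite perm_cat2l perm_cons perm_sym (permPl (permEl (perm_catCA p1 [:: z] p2))).
  by rewrite cat1s perm_cons perm_cat2r perm_sym perm_rev.
suff hs' : heavy_cycle s'.
  by have := maxs _ hs'; rewrite (perm_size Es') size_cat -[leqRHS]add0n leq_add2r.
split.
- rewrite (perm_uniq Es') cat_uniq Uq Us andbT andTb.
  by apply/hasPn => u us; apply/negP=> /out; rewrite us.
- move: cs; rewrite /s' /= !rcons_cat /= !cat_path /= => /and3P[P1 P2 P3].
  have exy : e x y by rewrite e_sym.
  rewrite !sub_heavy_closure // (sub_path sub_heavy_closure pq) /=.
  case: p1 P1 P2 x1H {Ep hs ys maxs Us Hs s2 cp cs' out s' Es'} => [|x1 p1] //= P1 P2 x1H.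
  rewrite rcons_cat cat_path rev_cons last_rcons.
  have -> /= : path e' z (rcons (rev p1) x1).
    have := sym_rev_path heavy_closure_sym x1 (rcons p1 z).
    rewrite last_rcons belast_rcons rev_cons => ->.
    by case/andP: P1 => _ P1; rewrite rcons_path P1 P2.
  case: p2 P3 z1H => [|z1 p2] /=; first by rewrite /heavy_closure x1H => _ ->; rewrite orbT.
  by case/andP=> _ ->; rewrite /heavy_closure x1H => ->; rewrite orbT.
- by move=> h /Hs hs'; rewrite (perm_mem Es') mem_cat hs' orbT.
- by rewrite (perm_size Es') size_cat ltn_addl.
Qed.

(** Two or more heavy vertices form one in any order; a single one forms a triangle with two light
    neighbours. *)
Lemma heavy_cycle_exists : exists s, heavy_cycle s.
Proof.
pose H := enum [set x | heavy x].
have mH x : (x \in H) = heavy x by rewrite mem_enum inE.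
have UH : uniq H by apply: enum_uniq.
have [H1|H1] := ltnP 1 (size H).
  exists H; split=> // [|h]; last by rewrite mH.
  have pH x p : {subset x :: p <= H} -> path e' x p.
    elim: p x => //= y p IHp x sub; rewrite IHp ?andbT => [|u up].
      by rewrite /heavy_closure -!mH !sub ?orbT // !inE eqxx ?orbT.
    by apply: sub; rewrite inE up orbT.
  case: (H) pH => [//|x p] pH; apply: pH => u.
  by rewrite !(inE, mem_rcons) orbA orbb.
have [a [b [ha hb ab]]] := two_nbrs h0.
have onlyh x : heavy x -> x = h0.
  move: H1; rewrite -mH; have := heavy_h0; rewrite -mH.
  by case: (H) => [|u [|]] //; rewrite !inE => /eqP-> _ /eqP->.
have La : light a by apply/negP => /onlyh E; rewrite E e_irr in ha.
have Lb : light b by apply/negP => /onlyh E; rewrite E e_irr in hb.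
have eab := heavy_clique heavy_h0 La Lb ha hb ab.
have bh0 : e b h0 by rewrite e_sym.
exists [:: h0; a; b]; split=> //.
- by rewrite /= !inE negb_or (edge_neq ha) (edge_neq hb) ab.
- by rewrite /= !sub_heavy_closure.
- by move=> h /onlyh->; rewrite inE eqxx.
Qed.

Lemma hamiltonian_heavy_closure :
  exists s, hamiltonian_cycle e' s.
Proof.
(* Tuples of fixed length make the property boolean, as [ex_maxnP] needs. *)
pose P k := [exists t : k.-tuple T,
  [&& uniq t, cycle e' t, [forall h, heavy h ==> (h \in t)] & 1 < size t]].
have PP k : reflect (exists2 s, heavy_cycle s & size s = k) (P k).
  apply: (iffP existsP) => [[t /and4P[Ut ct /forallP Ht t2]]|[s [Us cs Hs s2] <-]].
    by exists t; rewrite ?size_tuple //; split=> // h; apply/implyP.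
  exists (in_tuple s); rewrite Us cs s2 andbT /=.
  by apply/forallP=> h; apply/implyP/Hs.
have [s0 hs0] := heavy_cycle_exists.
have exP : exists k, P k by exists (size s0); apply/PP; exists s0.
have leP k : P k -> k <= #|T|.
  by case/PP=> s [/card_uniqP<- _ _ _] <-; apply: max_card.
case: (ex_maxnP exP leP) => k /PP[s hs <-] maxk.
have [Us cs _ _] := hs; exists s; split=> // x; apply: contraT => xs.
by case: (heavy_cycle_extend hs xs) => s' hs'; apply: maxk; apply/PP; exists s'.
Qed.

End OneHeavy.

(** * Two consecutive heavy vertices on a Hamiltonian cycle *)

Lemma heavy_edge_on_hamiltonian_cycle s h :
  hamiltonian_cycle e s -> heavy h -> 2 < #|T| ->
  exists2 x, heavy x & heavy (next s x).
Proof.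
case=> Us cs fs Hh n3.
have [/existsP[x /andP[]]|/existsPn none] :=
  boolP [exists x, heavy x && heavy (next s x)]; first by exists x.
exfalso.
have Lnext x : heavy x -> light (next s x) by move=> Hx; have := none x; rewrite Hx.
have Lprev x : heavy x -> light (prev s x).
  by move=> Hx; apply/negP=> /Lnext; rewrite next_prev // Hx.
have e_next x : e x (next s x) by apply: next_cycle.
have e_prev x : e x (prev s x) by rewrite e_sym; apply: prev_cycle.
have next_neq_prev x : next s x != prev s x.
  apply: next_neq_prev => //; have /card_uniqP <- := Us; apply: leq_trans n3 _.
  by apply/subset_leq_card/subsetP => y _; apply: fs.
(* Nonadjacent a and c would both be adjacent to g by domination, against [heavy_clique]. *)
have clique_at x a c : light x -> (exists2 g, heavy g & e x g) ->
    light a -> light c -> e x a -> e x c -> a != c -> e a c.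
  move=> Lx [g Hg xg] La Lc xa xc ac; apply: contraT => nac.
  have ga : g != a by apply: contraNneq La => <-.
  have gc : g != c by apply: contraNneq Lc => <-.
  have /andP[ga' gc'] := dominate La Lc xa xc ac nac xg ga gc.
  by rewrite (heavy_clique Hg) in nac.
pose x0 := next s h; pose y0 := prev s h.
have Lx0 : light x0 by apply: Lnext.
have Ly0 : light y0 by apply: Lprev.
have hx0 : e x0 h by rewrite e_sym.
have hy0 : e y0 h by rewrite e_sym.
have x0y0 : e x0 y0.
  exact: heavy_clique Hh Lx0 Ly0 (e_next h) (e_prev h) (next_neq_prev h).
(* Q is closed under adjacency of light vertices, and contains the light vertices
   on both sides of a heavy one as soon as it contains one of them. *)
pose Q w := (w == x0) || e x0 w.
have closed_Q z w : light z -> light w -> Q z -> e z w -> Q w.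
  move=> Lz Lw; rewrite /Q => /orP[/eqP->|x0z] zw; first by rewrite zw orbT.
  have [//|wx0 /=] := altP (w =P x0); have [->//|wy0] := altP (w =P y0).
  have zx0 : e z x0 by rewrite e_sym.
  apply: contraT => nx0w.
  (* If z is not [y0], the two are adjacent by [clique_at] at [x0]; domination at z for the pair
     [x0], w gives the edge. *)
  have y0w : e y0 w.
    have [<-//|zy0] := altP (z =P y0).
    have zy0' : e z y0 by apply: (clique_at x0) => //; exists h.
    have wx0' : x0 != w by rewrite eq_sym.
    have y0x0 : y0 != x0 by rewrite eq_sym (edge_neq x0y0).
    have y0w : y0 != w by rewrite eq_sym.
    by have /andP[] := dominate Lx0 Lw zx0 zw wx0' nx0w zy0' y0x0 y0w.
  case/negP: nx0w; apply: (clique_at y0) => //; [by exists h|by rewrite e_sym|by rewrite eq_sym].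
(* Induction along the cycle: at a heavy u the invariant is kept at [prev s u], which is light and
   adjacent to [next s u]. *)
have all_Q u : (light u -> Q u) /\ (heavy u -> Q (prev s u)).
  move: u; apply: (@cycle_ind T s _ x0) => // [|u [IHl IHh]].
    by split=> [_|]; rewrite ?(negPf Lx0) // /Q eqxx.
  have [Hu|Lu] := boolP (heavy u).
    split; last by rewrite (negPf (Lnext _ Hu)).
    move=> Ln; apply: (closed_Q (prev s u)) => //; try exact: Lprev; try exact: IHh.
    by apply: (heavy_clique Hu) => //; [exact: Lprev|rewrite eq_sym].
  split=> [Ln|_]; last by rewrite prev_next //; apply: IHl.
  by apply: (closed_Q u) => //; apply: IHl.
pose H := [set u | heavy u]; pose L := [set u | ~~ heavy u].
have nHL : #|H| + #|L| = #|T|.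
  by rewrite -(cardsC H); congr (_ + _); apply: eq_card => u; rewrite !inE.
have degL : #|L :\ x0| < degree e x0.
  have sub : h |: L :\ x0 \subset [set u | e x0 u].
    apply/subsetP=> u; rewrite !inE => /orP[/eqP->//|/andP[ux0 Lu]].
    by have [/(_ Lu)] := all_Q u; rewrite /Q (negPf ux0).
  have := subset_leq_card sub; rewrite cardsU1 !inE Hh andbF /=.
  by [].
have x0L : x0 \in L by rewrite inE.
have imL : next s @: H \subset L.
  by apply/subsetP=> _ /imsetP[u Hu ->]; rewrite inE in Hu; rewrite inE Lnext.
have imH : #|next s @: H| = #|H| by apply: card_imset; apply: next_inj.
move: Lx0; rewrite /heavy_vertex -nHL -imH => Lx0'.
have cL := cardsD1 x0 L; rewrite x0L in cL.
(* So far [x0] has degree at least |L|, and |H| <= |L|. If [next s x0] is heavy, it is one more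
   neighbour; if light, it is not the successor of a heavy vertex, so |H| < |L|. Either way [x0] is
   heavy. *)
have [Hn|Ln] := boolP (heavy (next s x0)).
  have : #|next s x0 |: (h |: L :\ x0)| <= degree e x0.
    apply/subset_leq_card/subsetP=> u; rewrite !inE => /or3P[/eqP->//|/eqP->//|/andP[ux0 Lu]].
    by have [/(_ Lu)] := all_Q u; rewrite /Q (negPf ux0).
  rewrite !cardsU1 !inE Hn Hh !andbF !orbF /=.
  rewrite (_ : next s x0 != h); last first.
    have := next_neq_prev x0; rewrite /x0 prev_next //.
  by have := subset_leq_card imL; lia.
have nimg : next s x0 \notin next s @: H.
  apply/imsetP=> -[u Hu /next_inj-/(_ Us) E].
  by move: Hu; rewrite -E !inE => Hx; rewrite (negPf (Lnext _ Hh)) in Hx.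
have : next s x0 |: next s @: H \subset L.
  by rewrite subUset imL andbT sub1set inE.
by move/subset_leq_card; rewrite cardsU1 nimg; lia.
Qed.

End Dominated.

End HeavyVertices.

Theorem theorem9 (T : finType) (e : rel T)
  (e_sym : symmetric e) (e_irr : irreflexive e)
  (H2c : two_connected e) (Hnc : ~ is_cycle_graph e)
  (Hheavy : claw_Z1_f1_heavy e) :
  pancyclic e.
Proof.
have dom := light_nbrs_dominate e_sym e_irr Hheavy.
have [n3 _ _] := H2c.
have [/existsP[h Hh]|/existsPn noH] := boolP [exists h, heavy_vertex e h]; last first.
  by case: Hnc; apply: degree_le2_cycle => //; apply: degree_le2.
(* A boolean form of the failure of [heavy_clique], to decide whether it occurs. *)
pose bad (t : T * T * T) := let: (g, a, c) := t in
  [&& heavy_vertex e g, ~~ heavy_vertex e a, ~~ heavy_vertex e c, e g a &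
      [&& e g c, a != c & ~~ e a c]].
have [/existsP[[[g a] c] /and5P[Hg La Lc ga /and3P[gc ac nac]]]|noB] :=
  boolP [exists t, bad t].
  exact: (light_nbrs_adj_or_pancyclic e_sym e_irr H2c dom Hg La Lc ga gc ac nac).
have clique g a c : heavy_vertex e g -> ~~ heavy_vertex e a ->
    ~~ heavy_vertex e c -> e g a -> e g c -> a != c -> e a c.
  move=> Hg La Lc ga gc ac; apply: contraNT noB => nac.
  by apply/existsP; exists (g, a, c); rewrite /bad Hg La Lc ga gc ac nac.
have [s0 hs0] := hamiltonian_heavy_closure e_sym e_irr H2c dom clique Hh.
have [s hs] := hamiltonian_from_closure e_sym e_irr hs0.
have [x Hx Hnx] := heavy_edge_on_hamiltonian_cycle e_sym e_irr dom clique hs Hh n3.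
exact: heavy_edge_pancyclic hs Hx Hnx n3.
Qed.
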